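(* Let $R$ be a commutative ring with unity. Then $R$ is a binomial ring if and only if it can be equipped with unary operations $r\mapsto \binom{r}{n}$ ($n\in\mathbb{N}=\{0,1,2,\dots\}$) from $R$ to $R$ satisfying the following five axioms for all $a,b\in R$ and all $m,n\in\mathbb{N}$: (I) $\displaystyle \binom{a+b}{n} = \sum_{p+q=n} \binom{a}{p} \binom{b}{q}$ (sum over $p,q\in\mathbb{N}$); (II) $\displaystyle \binom{ab}{n} = \sum_{m=0}^{n} \binom{a}{m} \sum_{\substack{q_1+\cdots+q_m=n \\ q_i\geq 1}} \binom{b}{q_1}\cdots\binom{b}{q_m}$; (III) $\displaystyle \binom{a}{m}\binom{a}{n} = \sum_{k=0}^{n} \binom{a}{m+k}\binom{m+k}{n}\binom{n}{k}$; (IV) $\displaystyle \binom{1}{n}=0$ when $n\geq 2$; (V) $\displaystyle \binom{a}{0}=1$ and $\displaystyle \binom{a}{1}=a$.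
   Context: A commutative ring $R$ with unity is a binomial ring if it is torsion-free as a $\mathbb{Z}$-module and, regarded as a subring of $\mathbb{Q}\otimes_{\mathbb{Z}} R$, is closed under the operations $r\mapsto \frac{r(r-1)\cdots(r-n+1)}{n!}$ for all $n\in\mathbb{N}$. In axiom (III), the coefficients $\binom{m+k}{n}$ and $\binom{n}{k}$ are the ordinary integer binomial coefficients. In axiom (II), for $m=0$ the inner sum is $1$ if $n=0$ (the empty tuple, with empty product) and $0$ if $n\ge 1$. *)

(* Defs.v *)
From HB Require Import structures.
From mathcomp Require Import all_boot all_order all_algebra.
From mathcomp Require Import boolp.
From mathcomp Require Import zify.

Set Implicit Arguments.
Unset Strict Implicit.
Unset Printing Implicit Defensive.

Import Order.TTheory GRing.Theory Num.Theory.
Local Open Scope ring_scope.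
Local Open Scope quotient_scope.

(* The Q-algebra [rtens R] is the standard model of the tensor product of the
   Z-modules Q and R: the localization of R at the positive integers. A pair
   [(x, k)] stands for [(1 / k.+1) (x) x]; the shift keeps denominators
   positive. The factor [l.+1] in the equivalence is needed because R may have
   torsion. The tensor product's universal property is [rtens_universal]. *)
Section RationalTensor.
Variable R : comPzRingType.

Definition rtens_rel (u v : R * nat) : bool :=
  `[< exists l : nat, u.1 *+ v.2.+1 *+ l.+1 = v.1 *+ u.2.+1 *+ l.+1 >].

Lemma rtens_rel_refl : reflexive rtens_rel.
Proof. by move=> u; apply/asboolP; exists 0%N. Qed.

Lemma rtens_rel_sym : symmetric rtens_rel.
Proof.
by move=> u v; apply/asboolP/asboolP => -[l e]; exists l; rewrite e.
Qed.

Lemma rtens_rel_trans : transitive rtens_rel.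
Proof.
move=> [y b] [x a] [z c] /asboolP[/= l e1] /asboolP[/= m e2].
apply/asboolP; exists (b.+1 * l.+1 * m.+1).-1; rewrite prednK ?muln_gt0//=.
transitivity (x *+ b.+1 *+ l.+1 *+ (c.+1 * m.+1)).
  by rewrite -!mulrnA; congr (_ *+ _); lia.
rewrite e1.
transitivity (y *+ c.+1 *+ m.+1 *+ (a.+1 * l.+1)).
  by rewrite -!mulrnA; congr (_ *+ _); lia.
by rewrite e2 -!mulrnA; congr (_ *+ _); lia.
Qed.

Canonical rtens_equiv :=
  EquivRel rtens_rel rtens_rel_refl rtens_rel_sym rtens_rel_trans.

Definition rtens := {eq_quot rtens_rel}.
HB.instance Definition _ : EqQuotient _ rtens_rel rtens := EqQuotient.on rtens.
HB.instance Definition _ := Choice.on rtens.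

(* [rfrac x d] is [(1 / d) (x) x], for [d > 0] only. *)
Definition rfrac (x : R) (d : nat) : rtens := \pi_rtens (x, d.-1).

Lemma rfracP (x y : R) d e : (0 < d)%N -> (0 < e)%N ->
  rfrac x d = rfrac y e <->
  exists2 l, (0 < l)%N & x *+ (e * l) = y *+ (d * l).
Proof.
case: d e => [//|d] [//|e] _ _; split.
  by move/eqmodP => /asboolP[/= l h]; exists l.+1; rewrite // !mulrnA.
case=> -[//|l] _ h; apply/eqmodP/asboolP; exists l => /=.
by rewrite -!mulrnA.
Qed.

Lemma rfrac_eq (x y : R) d e : (0 < d)%N -> (0 < e)%N ->
  x *+ e = y *+ d -> rfrac x d = rfrac y e.
Proof. by move=> d0 e0 h; apply/rfracP => //; exists 1%N; rewrite ?muln1. Qed.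

Lemma rfracW (P : rtens -> Prop) :
  (forall x d, (0 < d)%N -> P (rfrac x d)) -> forall u, P u.
Proof. by move=> h; elim/quotW => -[x d]; exact: (h x d.+1). Qed.

Definition rtens_add (u v : rtens) : rtens :=
  let: (x, d) := repr u in let: (y, e) := repr v in
  rfrac (x *+ e.+1 + y *+ d.+1) (d.+1 * e.+1).
Definition rtens_opp (u : rtens) : rtens :=
  let: (x, d) := repr u in rfrac (- x) d.+1.
Definition rtens_mul (u v : rtens) : rtens :=
  let: (x, d) := repr u in let: (y, e) := repr v in
  rfrac (x * y) (d.+1 * e.+1).
(* A representative of [rfrac x d], as an equation up to a factor. *)
Variant repr_rfrac_spec (x : R) (d : nat) : R * nat -> Type :=
  ReprRfrac y e l of (0 < l)%N & x *+ (e.+1 * l) = y *+ (d * l) :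
    repr_rfrac_spec x d (y, e).

Lemma repr_rfracP x d : (0 < d)%N -> repr_rfrac_spec x d (repr (rfrac x d)).
Proof.
move=> d0; case E : (repr _) => [y e].
have : rfrac x d = rfrac y e.+1 by rewrite /rfrac/= -E reprK.
by move/rfracP => /(_ d0 isT) /cid2[l l0 h]; exists l.
Qed.

Lemma rtens_addE x y d e : (0 < d)%N -> (0 < e)%N ->
  rtens_add (rfrac x d) (rfrac y e) = rfrac (x *+ e + y *+ d) (d * e).
Proof.
move=> d0 e0; rewrite /rtens_add.
case: (repr_rfracP x d0) => x' d' l l0 hx.
case: (repr_rfracP y e0) => y' e' m m0 hy.
apply/rfracP; rewrite ?muln_gt0 ?d0 ?e0//.
exists (l * m)%N; rewrite ?muln_gt0 ?l0 ?m0//.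
rewrite !mulrnDl -!mulrnA; congr (_ + _).
  transitivity (x' *+ (d * l) *+ (e'.+1 * e * m)).
    by rewrite -!mulrnA; congr (_ *+ _); lia.
  by rewrite -hx -!mulrnA; congr (_ *+ _); lia.
transitivity (y' *+ (e * m) *+ (d'.+1 * d * l)).
  by rewrite -!mulrnA; congr (_ *+ _); lia.
by rewrite -hy -!mulrnA; congr (_ *+ _); lia.
Qed.

Lemma rtens_oppE x d : (0 < d)%N -> rtens_opp (rfrac x d) = rfrac (- x) d.
Proof.
move=> d0; rewrite /rtens_opp; case: (repr_rfracP x d0) => y e l l0 h.
by apply/rfracP => //; exists l; rewrite // !mulNrn h.
Qed.

Lemma rtens_mulE x y d e : (0 < d)%N -> (0 < e)%N ->
  rtens_mul (rfrac x d) (rfrac y e) = rfrac (x * y) (d * e).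
Proof.
move=> d0 e0; rewrite /rtens_mul.
case: (repr_rfracP x d0) => x' d' l l0 hx.
case: (repr_rfracP y e0) => y' e' m m0 hy.
apply/rfracP; rewrite ?muln_gt0 ?d0 ?e0//.
exists (l * m)%N; rewrite ?muln_gt0 ?l0 ?m0//.
transitivity ((x' *+ (d * l)) * (y' *+ (e * m))).
  by rewrite mulrnAl mulrnAr -!mulrnA; congr (_ *+ _); lia.
rewrite -hx -hy.
by rewrite mulrnAl mulrnAr -!mulrnA; congr (_ *+ _); lia.
Qed.

Lemma absz_denq_gt0 (q : rat) : (0 < `|denq q|)%N.
Proof. by rewrite absz_gt0 denq_neq0. Qed.

Fact rtens_addA : associative rtens_add.
Proof.
elim/rfracW=> x d d0; elim/rfracW=> y e e0; elim/rfracW=> z f f0.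
rewrite !rtens_addE ?muln_gt0 ?d0 ?e0 ?f0//.
rewrite !mulrnDl -!mulrnA addrA.
by congr (rfrac (_ *+ _ + _ *+ _ + _ *+ _) _); lia.
Qed.

Fact rtens_addC : commutative rtens_add.
Proof.
elim/rfracW=> x d d0; elim/rfracW=> y e e0.
by rewrite !rtens_addE// addrC mulnC.
Qed.

Fact rtens_add0 : left_id (rfrac 0 1) rtens_add.
Proof.
elim/rfracW=> x d d0.
by rewrite rtens_addE// mul0rn add0r mulr1n mul1n.
Qed.

Fact rtens_addN : left_inverse (rfrac 0 1) rtens_opp rtens_add.
Proof.
elim/rfracW=> x d d0; rewrite rtens_oppE// rtens_addE// mulNrn addNr.
by apply: rfrac_eq; rewrite ?muln_gt0 ?d0 // !mul0rn.
Qed.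

HB.instance Definition _ :=
  GRing.isZmodule.Build rtens rtens_addA rtens_addC rtens_add0 rtens_addN.

Lemma rfracD x y d e : (0 < d)%N -> (0 < e)%N ->
  rfrac x d + rfrac y e = rfrac (x *+ e + y *+ d) (d * e).
Proof. exact: rtens_addE. Qed.

Fact rtens_mulA : associative rtens_mul.
Proof.
elim/rfracW=> x d d0; elim/rfracW=> y e e0; elim/rfracW=> z f f0.
by rewrite !rtens_mulE ?muln_gt0 ?d0 ?e0 ?f0// mulrA mulnA.
Qed.

Fact rtens_mulC : commutative rtens_mul.
Proof.
elim/rfracW=> x d d0; elim/rfracW=> y e e0.
by rewrite !rtens_mulE// mulrC mulnC.
Qed.

Fact rtens_mul1 : left_id (rfrac 1 1) rtens_mul.
Proof.
by elim/rfracW=> x d d0; rewrite rtens_mulE// mul1r mul1n.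
Qed.

Fact rtens_mulDl : left_distributive rtens_mul +%R.
Proof.
elim/rfracW=> x d d0; elim/rfracW=> y e e0; elim/rfracW=> z f f0.
rewrite !rfracD// !rtens_mulE ?muln_gt0 ?d0 ?e0//.
rewrite rfracD ?muln_gt0 ?d0 ?e0 ?f0//.
apply: rfrac_eq; rewrite ?muln_gt0 ?d0 ?e0 ?f0//.
rewrite mulrDl !mulrnAl !mulrnDl -!mulrnA.
by congr (_ *+ _ + _ *+ _); lia.
Qed.

HB.instance Definition _ := GRing.Zmodule_isComPzRing.Build rtens
  rtens_mulA rtens_mulC rtens_mul1 rtens_mulDl.

Lemma rfracM x y d e : (0 < d)%N -> (0 < e)%N ->
  rfrac x d * rfrac y e = rfrac (x * y) (d * e).
Proof. exact: rtens_mulE. Qed.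

(* The ring morphism [q |-> q (x) 1] from Q. *)
Definition rtens_rat (q : rat) : rtens := rfrac (numq q)%:~R `|denq q|.

Lemma rtens_rat_div (a : int) (d : nat) : (0 < d)%N ->
  rtens_rat (a%:~R / d%:R) = rfrac a%:~R d.
Proof.
move=> d0; set q := _ / _; apply: rfrac_eq; rewrite ?absz_gt0 ?denq_neq0//.
have /intr_inj e : (numq q * d)%:~R = (a * denq q)%:~R :> rat.
  rewrite !intrM numqE -mulrA [_ * d%:~R]mulrC mulrA; congr (_ * _).
  by rewrite /q divfK// pnatr_eq0 -lt0n.
by rewrite -[LHS]mulr_natr -[RHS]mulr_natr !pmulrn -!intrM absz_denq e.
Qed.

Fact rtens_rat1 : rtens_rat 1 = 1.
Proof. by []. Qed.

Lemma ratdivP (q : rat) :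
  exists a : int, exists2 d, (0 < d)%N & q = a%:~R / d%:R.
Proof.
exists (numq q); exists `|denq q|%N; first by rewrite absz_gt0 denq_neq0.
by rewrite pmulrn absz_denq divq_num_den.
Qed.

Fact rtens_ratD : {morph rtens_rat : p q / p + q}.
Proof.
move=> p q; have [a [d d0 ->]] := ratdivP p; have [b [e e0 ->]] := ratdivP q.
have dn : d%:R != 0 :> rat by rewrite pnatr_eq0 -lt0n.
have en : e%:R != 0 :> rat by rewrite pnatr_eq0 -lt0n.
rewrite addf_div// !pmulrn -!intrM -intrD -PoszM -!pmulrn.
rewrite !rtens_rat_div ?muln_gt0 ?d0// rfracD//.
by rewrite intrD !intrM -!pmulrn !mulr_natr.
Qed.

Fact rtens_ratM : {morph rtens_rat : p q / p * q}.
Proof.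
move=> p q; have [a [d d0 ->]] := ratdivP p; have [b [e e0 ->]] := ratdivP q.
rewrite mulf_div -intrM -natrM !rtens_rat_div ?muln_gt0 ?d0// rfracM//.
by rewrite intrM.
Qed.

Definition rtens_scale (q : rat) (u : rtens) : rtens := rtens_rat q * u.

Fact rtens_scaleA p q u :
  rtens_scale p (rtens_scale q u) = rtens_scale (p * q) u.
Proof. by rewrite /rtens_scale mulrA -rtens_ratM. Qed.

Fact rtens_scale1 : left_id 1 rtens_scale.
Proof. by move=> u; rewrite /rtens_scale rtens_rat1 mul1r. Qed.

Fact rtens_scaleDr : right_distributive rtens_scale +%R.
Proof. by move=> q u v; rewrite /rtens_scale mulrDr. Qed.

Fact rtens_scaleDl u : {morph rtens_scale^~ u : p q / p + q}.
Proof. by move=> p q; rewrite /rtens_scale rtens_ratD mulrDl. Qed.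

HB.instance Definition _ := GRing.Zmodule_isLmodule.Build rat rtens
  rtens_scaleA rtens_scale1 rtens_scaleDr rtens_scaleDl.

Lemma rtens_scalerAl (q : rat) (u v : rtens) : q *: (u * v) = q *: u * v.
Proof. exact: mulrA. Qed.

(* The structural map [x |-> 1 (x) x]. *)
Definition rtens_in (x : R) : rtens := rfrac x 1.

Fact rtens_in_is_zmod_morphism : zmod_morphism rtens_in.
Proof.
move=> x y; rewrite /rtens_in -[- rfrac y 1]/(rtens_opp _) rtens_oppE//.
by rewrite rfracD.
Qed.

Fact rtens_in_is_monoid_morphism : monoid_morphism rtens_in.
Proof. by split=> [//|x y]; rewrite /rtens_in rfracM. Qed.

HB.instance Definition _ :=
  GRing.isZmodMorphism.Build R rtens rtens_in rtens_in_is_zmod_morphism.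
HB.instance Definition _ :=
  GRing.isMonoidMorphism.Build R rtens rtens_in rtens_in_is_monoid_morphism.

Lemma rfracE x d : (0 < d)%N -> rfrac x d = d%:R^-1 *: rtens_in x.
Proof.
move=> d0; rewrite -[RHS]/(rtens_rat _ * rfrac x 1).
by rewrite -[_^-1]mul1r (rtens_rat_div 1)// rfracM// mul1r muln1.
Qed.

Lemma rtens_universal (M : zmodType) (f : rat -> R -> M) :
    (forall p q x, f (p + q) x = f p x + f q x) ->
    (forall q x y, f q (x + y) = f q x + f q y) ->
  exists! g : rtens -> M,
    (forall u v, g (u + v) = g u + g v) /\
    (forall q x, g (q *: rtens_in x) = f q x).
Proof.
move=> fDl fDr.
have f0r q : f q 0 = 0 by apply: (addIr (f q 0)); rewrite -fDr !add0r.
have f0l x : f 0 x = 0 by apply: (addIr (f 0 x)); rewrite -fDl !add0r.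
have fMr q x n : f q (x *+ n) = f q x *+ n.
  by elim: n => [|n IH]; rewrite ?f0r// !mulrSr fDr IH.
have fMl q x n : f (q *+ n) x = f q x *+ n.
  by elim: n => [|n IH]; rewrite ?f0l// !mulrSr fDl IH.
have fNr q x : f q (- x) = - f q x.
  by apply: (addIr (f q x)); rewrite -fDr !addNr f0r.
have fNl q x : f (- q) x = - f q x.
  by apply: (addIr (f q x)); rewrite -fDl !addNr f0l.
have fswap q x n : f (q *+ n) x = f q (x *+ n) by rewrite fMl fMr.
have fZ (a : int) q x : f (q *~ a) x = f q (x *~ a).
  by case: a => n; rewrite ?NegzE ?mulrNz -?pmulrn ?fNl ?fNr fswap.
have split_den (d k : nat) : (0 < d)%N -> (0 < k)%N ->
    d%:R^-1 = (d * k)%:R^-1 *+ k :> rat.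
  move=> d0 k0; rewrite natrM invfM -mulrnAr -[_ *+ k]mulr_natr mulVf ?mulr1//.
  by rewrite pnatr_eq0 -lt0n.
pose g (u : rtens) := let: (x, d) := repr u in f d.+1%:R^-1 x.
have gE x d : (0 < d)%N -> g (rfrac x d) = f d%:R^-1 x.
  move=> d0; rewrite /g; case: (repr_rfracP x d0) => y e l l0 h.
  rewrite (@split_den d (e.+1 * l)) ?muln_gt0//.
  rewrite (@split_den e.+1 (d * l)) ?muln_gt0 ?d0// !fswap h.
  by congr (f _%:R^-1 _); lia.
exists g; split; first split.
- elim/rfracW=> x d d0; elim/rfracW=> y e e0.
  rewrite rfracD// !gE ?muln_gt0 ?d0// fDr (split_den d e)//.
  by rewrite (split_den e d)// !fswap mulnC.
- move=> q x; rewrite -[q *: _]/(rtens_rat q * rfrac x 1).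
  rewrite rfracM ?absz_gt0 ?denq_neq0// gE ?muln1 ?absz_gt0 ?denq_neq0//.
  rewrite mulrC mulrzr -fZ; congr (f _ x).
  by rewrite -mulrzl pmulrn absz_denq divq_num_den.
- move=> h [_ hE]; apply/funext; elim/rfracW=> x d d0.
  by rewrite gE// rfracE// hE.
Qed.

End RationalTensor.

Definition torsion_free (V : zmodType) : Prop :=
  forall (n : int) (x : V), n != 0 -> x *~ n = 0 -> x = 0.

(* Thanks to this, torsion-free rings are regarded as subrings of Q (x) R. *)
Lemma rtens_in_inj (R : comPzRingType) :
  torsion_free R -> injective (@rtens_in R).
Proof.
move=> tf x y /rfracP -/(_ isT isT)[l l0]; rewrite !mul1n => h.
apply/eqP; rewrite -subr_eq0; apply/eqP; apply: (tf l) => //.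
  by rewrite -lt0n.
by rewrite -pmulrn mulrnBl h subrr.
Qed.

Definition rtens_binom (R : comPzRingType) (u : rtens R) (n : nat) : rtens R :=
  (n`!)%:R^-1 *: \prod_(i < n) (u - i%:R).

Definition binomial_ring (R : comPzRingType) : Prop :=
  torsion_free R /\
  forall (n : nat) (r : R),
    exists s : R, rtens_in s = rtens_binom (rtens_in r) n.

Record binomial_operations (R : comPzRingType) (bin : R -> nat -> R) : Prop :=
  BinomialOperations {
  binopD : forall (a b : R) (n : nat),
    bin (a + b) n = \sum_(p < n.+1) bin a p * bin b (n - p)%N;
  (* The parts [q i] of a composition of [n] are at most [n]. *)
  binopM : forall (a b : R) (n : nat),
    bin (a * b) n =
      \sum_(m < n.+1) bin a m *
        \sum_(q : {ffun 'I_m -> 'I_n.+1} |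
               ((\sum_i q i)%N == n) && [forall i, (0 < q i)%N])
          \prod_i bin b (q i);
  binop_mul : forall (a : R) (m n : nat),
    bin a m * bin a n =
      \sum_(k < n.+1) bin a (m + k)%N * 'C(m + k, n)%:R * 'C(n, k)%:R;
  binop1 : forall n : nat, (2 <= n)%N -> bin 1 n = 0;
  binop_deg01 : forall a : R, bin a 0%N = 1 /\ bin a 1%N = a
}.

(* Main.v *)
(** Write [(1 + X) ^ a] for the formal series with coefficients [bin a n].
    If [R] is binomial, these series are determined, as [R] is torsion-free,
    by [(1 + X) u' = a u] and [u 0 = 1]. For axioms (I) to (III), read as equalities
    of sequences in [n], both sides solve the same equation of this kind; (II)
    is [((1 + X) ^ b) ^ a = (1 + X) ^ (a b)].

    Conversely, axiom (III) with [n = 1] gives [n! bin a n = a (a - 1) ...].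
    For torsion, let [p] be a prime with [p r = 0]. Axiom (II) reads
    [1 = \sum_m bin r m ((1 + X) ^ p - 1) ^ m]. The coefficients of [X ^ k],
    [k < p], give [p ^ k bin r k = 0] by induction, and this persists for [k = p]
    by the recurrence for [bin r]. So in degree [p] only the term [m = 1]
    survives, and it is [r]. *)
Require Import Defs.
From mathcomp Require Import all_boot all_order all_algebra.
From mathcomp Require Import boolp zify ring.

Set Implicit Arguments.
Unset Strict Implicit.
Unset Printing Implicit Defensive.

Import GRing.Theory.
Local Open Scope ring_scope.

(** * Formal power series, as sequences of coefficients *)

Section FormalSeries.
Variable R : comPzRingType.
Implicit Types (u v w : nat -> R) (a b : R).

Definition conv u v n : R := \sum_(p < n.+1) u p * v (n - p)%N.

Definition cpow u m : nat -> R := iter m (conv u) (fun n => (n == 0)%:R).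
#[global] Arguments cpow : simpl never.

(* The coefficients of [(1 + X) u'] for the formal series [u]. *)
Definition der u n : R := n.+1%:R * u n.+1 + n%:R * u n.

(** For [u 0 = 1] this is the series [u - 1]; having no constant term, it can be substituted into
    any series, with finite sums in each degree. *)
Definition drop0 u n : R := if n is 0 then 0 else u n.

Lemma convu1 u n : conv u (fun k => (k == 0)%:R) n = u n.
Proof.
rewrite /conv big_ord_recr /= subnn mulr1 big1 ?add0r // => i _.
by rewrite subn_eq0 leqNgt ltn_ord mulr0.
Qed.

Lemma conv1u u n : conv (fun k => (k == 0)%:R) u n = u n.
Proof.
rewrite /conv big_ord_recl /= subn0 mul1r big1 ?addr0 // => i _.
by rewrite mul0r.
Qed.

Lemma der_conv u v n : der (conv u v) n = conv (der u) v n + conv u (der v) n.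
Proof.
have e1 : n.+1%:R * conv u v n.+1 =
    \sum_(p < n.+1) p.+1%:R * u p.+1 * v (n - p)%N +
    \sum_(p < n.+1) u p * ((n - p).+1%:R * v (n - p).+1).
  transitivity (\sum_(p < n.+2) p%:R * u p * v (n.+1 - p)%N +
                \sum_(p < n.+2) u p * ((n.+1 - p)%:R * v (n.+1 - p)%N)).
    rewrite /conv mulr_sumr -big_split; apply: eq_bigr => p _ /=.
    have -> : n.+1%:R = p%:R + (n.+1 - p)%:R :> R.
      by rewrite -natrD subnKC // -ltnS.
    by ring.
  congr (_ + _).
    by rewrite big_ord_recl !mul0r add0r; apply: eq_bigr => p _.
  rewrite big_ord_recr /= subnn mul0r mulr0 addr0; apply: eq_bigr => p _.
  by rewrite subSn // -ltnS.
rewrite /der e1 /conv mulr_sumr -!big_split; apply: eq_bigr => p _ /=.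
have -> : n%:R = p%:R + (n - p)%:R :> R by rewrite -natrD subnKC // -ltnS.
by ring.
Qed.

Lemma eq_conv u u' v v' : u =1 u' -> v =1 v' -> conv u v =1 conv u' v'.
Proof. by move=> eu ev n; apply: eq_bigr => p _; rewrite eu ev. Qed.

Lemma convr_lin u v w a n :
  conv u (fun k => a * (v k + w k)) n = a * (conv u v n + conv u w n).
Proof. by rewrite -big_split mulr_sumr; apply: eq_bigr => p _ /=; ring. Qed.

Lemma cpow_small u m n : u 0%N = 0 -> (n < m)%N -> cpow u m n = 0.
Proof.
move=> u0; elim: m n => [//|m IHm] n ltnm.
rewrite /cpow iterS -/(cpow u m) /conv big1 // => -[[|p] /= ltp] _.
  by rewrite u0 mul0r.
by rewrite IHm ?mulr0 //; lia.
Qed.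

Lemma cpow_diag u m : u 0%N = 0 -> cpow u m m = u 1%N ^+ m.
Proof.
move=> u0; elim: m => [//|m IHm].
rewrite /cpow iterS -/(cpow u m) /conv !big_ord_recl big1 /=.
  by rewrite u0 mul0r add0r addr0 /bump /= subSS subn0 IHm exprS.
move=> i _; rewrite cpow_small ?mulr0 //.
by have := ltn_ord i; rewrite /bump /=; lia.
Qed.

(** All [m] indices in a nonzero term are at least 1 and add up to [n], so each index [q] leaves at
    least [m - 1] for the others; hence the range [q + m <= n.+1]. *)
Lemma cpow_dvd u m n d : u 0%N = 0 ->
    (forall q, (0 < q)%N -> (q + m <= n.+1)%N -> exists z, u q = d * z) ->
  exists z, cpow u m n = d ^+ m * z.
Proof.
move=> u0; elim: m n => [|m IHm] n dvdu.
  by exists (n == 0)%:R; rewrite mul1r.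
pose P x := exists z, x = d ^+ m.+1 * z.
suff : P (conv u (cpow u m) n) by [].
rewrite /conv; apply: big_ind => [|x y [z ->] [t ->]|[[|p] /= ltp] _].
- by exists 0; rewrite mulr0.
- by exists (z + t); rewrite mulrDr.
- by exists 0; rewrite u0 mul0r mulr0.
case: (leqP m (n - p.+1)) => [lemp|]; last first.
  by move=> /(cpow_small u0)->; exists 0; rewrite !mulr0.
have [//||z ->] := dvdu p.+1; first lia.
have [|t ->] := IHm (n - p.+1)%N; last by exists (z * t); rewrite exprS; ring.
by move=> q q0 leq; apply: dvdu => //; lia.
Qed.

(** The bound [N] is independent of [n] so that, once the first part [x] is split off, the induction
    hypothesis applies to [n - x]. *)
Lemma sum_compositions u m N n : (n <= N)%N ->
  \sum_(q : {ffun 'I_m -> 'I_N.+1} | (\sum_i q i)%N == n) \prod_i u (q i) =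
  cpow u m n.
Proof.
elim: m n => [|m IHm] n lenN.
  under eq_bigl do rewrite big_ord0.
  under eq_bigr do rewrite big_ord0.
  rewrite /cpow /= eq_sym; case: eqP => _ /=; last by rewrite big_pred0.
  by rewrite sumr_const card_ffun !card_ord expn0.
pose h (x : 'I_N.+1 * {ffun 'I_m -> 'I_N.+1}) : {ffun 'I_m.+1 -> 'I_N.+1} :=
  [ffun i => if unlift ord0 i is Some j then x.2 j else x.1].
have h0 x : h x ord0 = x.1 by rewrite ffunE unlift_none.
have hS x i : h x (lift ord0 i) = x.2 i by rewrite ffunE liftK.
have hK : bijective h.
  exists (fun q : {ffun 'I_m.+1 -> 'I_N.+1} =>
    (q ord0, [ffun i => q (lift ord0 i)])) => [[x g]|q].
    by rewrite h0; congr (_, _); apply/ffunP => i; rewrite ffunE hS.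
  apply/ffunP => i; case: (unliftP ord0 i) => [j|] ->; last by rewrite h0.
  by rewrite hS ffunE.
transitivity (\sum_(x : 'I_N.+1)
    \sum_(g : {ffun 'I_m -> 'I_N.+1} | (x + \sum_i g i)%N == n)
      u x * \prod_i u (g i)).
  rewrite pair_big_dep (reindex h) /=; last exact: onW_bij.
  apply: eq_big => [x|x _]; rewrite big_ord_recl h0.
    by congr (_ + _ == _)%N; apply: eq_bigr => i _; rewrite hS.
  by congr (_ * _); apply: eq_bigr => i _; rewrite hS.
rewrite /cpow iterS -/(cpow u m) /conv.
rewrite (big_ord_widen N.+1 (fun p => u p * cpow u m (n - p)%N)) ?ltnS //.
rewrite [RHS]big_mkcond; apply: eq_bigr => x _; rewrite ltnS.
case: leqP => [lexn|ltnx]; last by rewrite big_pred0 // => g; apply/eqP; lia.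
rewrite -mulr_sumr -IHm; last lia.
by congr (_ * _); apply: eq_bigl => g; apply/eqP/eqP; lia.
Qed.

(** The inner sum of axiom (II) is a coefficient of a power: tuples with a zero part drop out since
    [drop0 u] vanishes at 0. *)
Lemma sum_positive_compositions u m n :
  \sum_(q : {ffun 'I_m -> 'I_n.+1} |
        ((\sum_i q i)%N == n) && [forall i, (0 < q i)%N]) \prod_i u (q i) =
  cpow (drop0 u) m n.
Proof.
pose positive (q : {ffun 'I_m -> 'I_n.+1}) := [forall i, (0 < q i)%N].
rewrite -(@sum_compositions _ m n n) // [RHS](bigID positive) /=.
rewrite [X in _ = _ + X]big1 ?addr0.
  apply: eq_bigr => q /andP[_ /forallP q0]; apply: eq_bigr => i _.
  by case: (q i : nat) (q0 i).
move=> q /andP[_]; rewrite negb_forall => /existsP[i].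
by rewrite -eqn0Ngt => /eqP q0; rewrite (bigD1 i) //= q0 mul0r.
Qed.

Lemma sum_pascal u n :
  \sum_(j < n.+2) u j * 'C(n.+1, j)%:R =
  \sum_(k < n.+1) (u k + u k.+1) * 'C(n, k)%:R.
Proof.
rewrite big_ord_recl.
under eq_bigr do rewrite /bump /= binS natrD mulrDr.
under [RHS]eq_bigr do rewrite mulrDl.
rewrite !big_split /= addrA; congr (_ + _).
rewrite big_ord_recr /= (bin_small (ltnSn n)) mulr0 addr0 [RHS]big_ord_recl.
by rewrite !bin0.
Qed.

(* With [f = 1 + g] this is [(1 + X) (g ^ m.+1)' = m.+1 b (g ^ m + g ^ m.+1)],
   as [(1 + X) f' = b f]. *)
Lemma der_cpow b u m n : u 0%N = 1 -> (forall k, der u k = b * u k) ->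
  der (cpow (drop0 u) m.+1) n =
    m.+1%:R * b * (cpow (drop0 u) m n + cpow (drop0 u) m.+1 n).
Proof.
move=> u0 deru; set g := drop0 u.
have derg k : der g k = b * ((k == 0)%:R + g k).
  have := deru k; case: k => [|k] /=.
    by rewrite /der /= u0 !mul0r !addr0 => ->.
  by rewrite add0r.
elim: m n => [|m IHm] n.
  transitivity (der g n); first by rewrite /der /cpow /= !convu1.
  by rewrite derg /cpow /= convu1 mul1r.
transitivity (der (conv g (cpow g m.+1)) n); first by [].
rewrite der_conv.
transitivity (b * (cpow g m.+1 n + cpow g m.+2 n) +
    m.+1%:R * b * (cpow g m.+1 n + cpow g m.+2 n)); last by ring.
congr (_ + _).
  rewrite -[cpow g m.+2 n]/(conv g (cpow g m.+1) n).
  rewrite -{1}(conv1u (cpow g m.+1) n).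
  rewrite /conv -big_split mulr_sumr.
  by apply: eq_bigr => p _ /=; rewrite derg; ring.
by rewrite (eq_conv (frefl g) IHm) convr_lin.
Qed.

(** By [der_cpow], the derivative of a power involves that power and the one below. After
    reindexing, the [m]-th power has coefficient [b * (m.+1 * u m.+1 + m * u m)], which is
    [b * a * u m]. *)
Lemma der_subst a b u v n : v 0%N = 1 ->
    (forall k, der u k = a * u k) -> (forall k, der v k = b * v k) ->
  der (fun k => \sum_(m < k.+1) u m * cpow (drop0 v) m k) n =
  a * b * \sum_(m < n.+1) u m * cpow (drop0 v) m n.
Proof.
move=> v0 deru derv; set c := cpow (drop0 v).
(* In degree [n], the sums up to [n] and up to [n.+1] therefore agree. *)
have cn : c n.+1 n = 0 by apply: cpow_small.
transitivity (\sum_(m < n.+2) u m * der (c m) n).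
  have cn0 : \sum_(m < n.+2) u m * c m n = \sum_(m < n.+1) u m * c m n.
    by rewrite big_ord_recr /= cn mulr0 addr0.
  rewrite /der -cn0.
  by rewrite !mulr_sumr -big_split; apply: eq_bigr => m _ /=; ring.
rewrite big_ord_recl [X in X + _](_ : _ = 0); last first.
  rewrite /der /c /cpow /=.
  by case: n {cn} => [|n] /=; rewrite !(mulr0, mul0r, addr0).
transitivity (\sum_(m < n.+1) b * (a * u m - m%:R * u m) * c m n +
    \sum_(m < n.+1) b * (m.+1%:R * u m.+1) * c m.+1 n).
  rewrite add0r -big_split; apply: eq_bigr => m _ /=.
  rewrite (der_cpow _ _ v0 derv) -/c -deru /der /bump /= add1n.
  by ring.
have -> : \sum_(m < n.+1) b * (m.+1%:R * u m.+1) * c m.+1 n =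
    \sum_(m < n.+1) b * (m%:R * u m) * c m n.
  transitivity (\sum_(m < n.+2) b * (m%:R * u m) * c m n).
    by rewrite [RHS]big_ord_recl /= mul0r mulr0 mul0r add0r.
  by rewrite big_ord_recr /= cn mulr0 addr0.
by rewrite -big_split mulr_sumr; apply: eq_bigr => m _ /=; ring.
Qed.

(** For axiom (III). Pascal's rule gives the terms of degrees [n] and [n.+1] the common factor
    ['C(n, k)]; the identities [e1] and [e2] then assemble [der u (m + k)]. *)
Lemma der_prod a u m n : (forall k, der u k = a * u k) ->
  der (fun i => \sum_(k < i.+1) u (m + k)%N * 'C(m + k, i)%:R * 'C(i, k)%:R) n =
  a * \sum_(k < n.+1) u (m + k)%N * 'C(m + k, n)%:R * 'C(n, k)%:R.
Proof.
move=> deru; rewrite /der.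
rewrite (sum_pascal (fun k => u (m + k)%N * 'C(m + k, n.+1)%:R)).
rewrite !mulr_sumr -big_split.
apply: eq_bigr => k _ /=.
have e1 : n.+1%:R * 'C(m + k.+1, n.+1)%:R =
    (m + k).+1%:R * 'C(m + k, n)%:R :> R.
  by rewrite addnS -!natrM mul_bin_diag.
have e2 : n.+1%:R * 'C(m + k, n.+1)%:R + n%:R * 'C(m + k, n)%:R =
    (m + k)%:R * 'C(m + k, n)%:R :> R.
  rewrite -!natrM -natrD mul_bin_left; congr (_%:R).
  (* The subtraction in [m + k - n] is truncated, but for [m + k < n] the binomial coefficient
     vanishes. *)
  case: (leqP n (m + k)) => [le|lt]; last by rewrite bin_small ?muln0 //.
  by rewrite -mulnDl subnK.
transitivity ((u (m + k)%N *
    (n.+1%:R * 'C(m + k, n.+1)%:R + n%:R * 'C(m + k, n)%:R) +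
  u (m + k.+1)%N * (n.+1%:R * 'C(m + k.+1, n.+1)%:R)) * 'C(n, k)%:R).
  by ring.
by rewrite e1 e2 !mulrA -deru /der addnS; ring.
Qed.

End FormalSeries.

(** * From the factorial formula to the axioms, without torsion *)

Lemma rtens_binomE (R : comPzRingType) (r : R) n :
  rtens_binom (rtens_in r) n = n`!%:R^-1 *: rtens_in (\prod_(i < n) (r - i%:R)).
Proof.
rewrite /rtens_binom rmorph_prod; congr (_ *: _); apply: eq_bigr => i _.
by rewrite rmorphB rmorph_nat.
Qed.

Lemma fact_ratr_neq0 n : n`!%:R != 0 :> rat.
Proof. by rewrite Num.Theory.pnatr_eq0 -lt0n fact_gt0. Qed.

Section TorsionFree.
Variable R : comPzRingType.
Hypothesis tfR : torsion_free R.

Lemma torsion_free_mulI n : (0 < n)%N -> injective (fun x : R => n%:R * x).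
Proof.
move=> n0 x y /eqP; rewrite -subr_eq0 -mulrBr => /eqP e.
apply/eqP; rewrite -subr_eq0; apply/eqP; apply: (tfR (n := n)).
  by rewrite -lt0n.
by rewrite -pmulrn -mulr_natl.
Qed.

Lemma rtens_in_binom (r s : R) n : rtens_in s = rtens_binom (rtens_in r) n ->
  n`!%:R * s = \prod_(i < n) (r - i%:R).
Proof.
move=> e; apply: (rtens_in_inj tfR).
rewrite rmorphM rmorph_nat /= e rtens_binomE mulr_natl -scaler_nat scalerA.
by rewrite mulfV ?scale1r // fact_ratr_neq0.
Qed.

Lemma eq_der a (u v : nat -> R) : u 0%N = v 0%N ->
    (forall n, der u n = a * u n) -> (forall n, der v n = a * v n) ->
  u =1 v.
Proof.
move=> e0 eu ev; elim=> [//|n IHn].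
apply: (@torsion_free_mulI n.+1) => //; apply: (addIr (n%:R * u n)).
by rewrite -[LHS]/(der u n) eu IHn -ev.
Qed.

Lemma binomial_operations_of_factorial (bin : R -> nat -> R) :
    (forall r n, n`!%:R * bin r n = \prod_(i < n) (r - i%:R)) ->
  binomial_operations bin.
Proof.
move=> binE.
have bin0 a : bin a 0%N = 1.
  by have := binE a 0%N; rewrite big_ord0 mul1r.
have der_bin a n : der (bin a) n = a * bin a n.
  have e : n.+1%:R * bin a n.+1 = (a - n%:R) * bin a n.
    apply: (torsion_free_mulI (fact_gt0 n)).
    rewrite [RHS]mulrCA binE mulrA -natrM.
    transitivity (n.+1`!%:R * bin a n.+1); first by rewrite factS mulnC.
    by rewrite binE big_ord_recr /= mulrC.
  by rewrite /der e; ring.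
split.
- move=> a b n; rewrite -/(conv (bin a) (bin b) n); move: n.
  apply: (@eq_der (a + b)) => [|n|n] //.
    by rewrite /conv big_ord1 !bin0 mulr1.
  rewrite der_conv /conv -big_split mulr_sumr.
  by apply: eq_bigr => p _ /=; rewrite !der_bin; ring.
- move=> a b n.
  under eq_bigr do rewrite sum_positive_compositions.
  move: n; apply: (@eq_der (a * b)) => [|n|n] //.
    by rewrite big_ord1 !bin0 mul1r.
  exact: der_subst.
- move=> a m n; move: n; apply: (@eq_der a) => [|n|n].
  + by rewrite big_ord1 bin0 addn0 !binomial.bin0 !mulr1.
  + have := der_bin a n; rewrite /der; set x := bin a n.+1 => e.
    transitivity (bin a m * (n.+1%:R * x + n%:R * bin a n)); first by ring.
    by rewrite e; ring.
  + exact: der_prod.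
- move=> n n2; apply: (torsion_free_mulI (fact_gt0 n)).
  (* [Ordinal n2] is the index 1, whose factor is [1 - 1]. *)
  by rewrite binE mulr0 (bigD1 (Ordinal n2)) //= subrr mul0r.
- move=> a; split=> //.
  by have := der_bin a 0%N; rewrite /der bin0 !mul1r mul0r addr0 mulr1.
Qed.

End TorsionFree.

(** * From the axioms to the factorial formula and torsion-freeness *)

Section Operations.
Variables (R : comPzRingType) (bin : R -> nat -> R).
Hypothesis binP : binomial_operations bin.

Let bin_0 a : bin a 0%N = 1. Proof. by case: (binop_deg01 binP a). Qed.
Let bin_1 a : bin a 1%N = a. Proof. by case: (binop_deg01 binP a). Qed.

Lemma binop_rec a n : n.+1%:R * bin a n.+1 = (a - n%:R) * bin a n.
Proof.
have := binop_mul binP a n 1; rewrite bin_1 !big_ord_recl big_ord0 /=.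
rewrite !addn0 addn1 !bin1 !binomial.bin0 !mulr1 addr0 => e.
by rewrite mulrBl [a * _]mulrC e; ring.
Qed.

Lemma binop_factorial a n : n`!%:R * bin a n = \prod_(i < n) (a - i%:R).
Proof.
elim: n => [|n IHn]; first by rewrite big_ord0 bin_0 mulr1.
by rewrite big_ord_recr -IHn /= factS mulnC natrM -mulrA binop_rec; ring.
Qed.

Lemma binop_succ a n : bin (a + 1) n.+1 = bin a n.+1 + bin a n.
Proof.
rewrite (binopD binP) !big_ord_recr /= subnn subSn // subnn bin_0 bin_1.
rewrite big1 => [|i _]; first by rewrite add0r !mulr1 addrC.
by rewrite (binop1 binP) ?mulr0 //; have := ltn_ord i; lia.
Qed.

Lemma binop_nat k n : bin k%:R n = 'C(k, n)%:R.
Proof.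
elim: k n => [|k IHk] [|n]; rewrite ?bin_0 //; last first.
  by rewrite -addn1 natrD binop_succ !IHk addn1 binS natrD.
(* Row 0: as [bin 1 n.+2 = 0], Pascal's rule carries the zero from [bin 0 n.+1] to [bin 0 n.+2]. *)
elim: n => [|n IHn]; first by rewrite bin_1.
have := binop_succ 0 n.+1.
by rewrite add0r (binop1 binP) // IHn addr0.
Qed.

Lemma prime_torsion p (r : R) : prime p -> p%:R * r = 0 -> r = 0.
Proof.
move=> p_pr pr0; have p1 := prime_gt1 p_pr.
pose c := cpow (drop0 (bin p%:R)).
have c0 k : (0 < k)%N -> c 0%N k = 0 by case: k.
have sum0 k : (0 < k)%N -> \sum_(m < k) bin r m.+1 * c m.+1 k = 0.
  move=> k0; have := binopM binP r p%:R k.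
  under eq_bigr do rewrite sum_positive_compositions.
  rewrite mulrC pr0 -[0](mulr0n 1) binop_nat bin0n eqn0Ngt k0.
  by rewrite big_ord_recl -/c c0 // mulr0 add0r => <-.
(* In this range only indices [q < p] occur, and there [p] divides ['C(p, q)]. *)
have c_dvd m k : (k.+1 < p + m)%N -> exists z, c m k = p%:R ^+ m * z.
  move=> ltk; apply: cpow_dvd => // q q0 leq.
  have ltqp : (q < p)%N by lia.
  have /dvdnP[z Ez] := prime_dvd_bin p_pr (introT andP (conj q0 ltqp)).
  exists z%:R; rewrite -natrM mulnC -Ez -binop_nat.
  by case: q q0 {leq ltqp Ez}.
have kill m : (0 < m < p)%N -> p%:R ^+ m * bin r m = 0.
  elim/ltn_ind: m => m IHm /andP[m0 ltmp].
  have := sum0 m m0; case: m m0 IHm ltmp => // m _ IHm ltmp.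
  rewrite big_ord_recr /= /c cpow_diag // /= bin_1 mulrC big1 ?add0r // => i _.
  have [|z] := c_dvd i.+1 m.+1; first by have := ltn_ord i; lia.
  rewrite /c => ->; rewrite mulrCA mulrA IHm ?mul0r //; have := ltn_ord i; lia.
(* Degree [p] is out of reach of [c_dvd] for [m = 1]; instead [p * bin r p] is a multiple of
   [bin r (p - 1)], which [p ^ (p - 1)] kills. *)
have kill_p : p%:R ^+ p * bin r p = 0.
  case: p p_pr p1 {pr0 c c0 sum0 c_dvd} kill => // p _ p1 kill.
  rewrite exprSr -mulrA binop_rec mulrCA kill ?mulr0 //; lia.
have := sum0 p (ltnW p1).
case: p p_pr p1 {pr0 c0 sum0} @c c_dvd kill kill_p => // p p_pr p1 c.
move=> c_dvd kill kill_p.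
rewrite big_ord_recl bin_1 big1 => [|i _].
  (* The coefficient of [r] is ['C(p.+1, p.+1)], that is, 1. *)
  by rewrite addr0 /c /cpow /= convu1 /= binop_nat binn mulr1.
rewrite lift0.
have [|z ->] := c_dvd i.+2 p.+1; first lia.
rewrite mulrCA mulrA.
case: (ltnP i.+2 p.+1) => [lt|ge]; first by rewrite kill ?mul0r.
have -> : i.+2 = p.+1 by have := ltn_ord i; lia.
by rewrite kill_p mul0r.
Qed.

Lemma binomial_operations_torsion_free : torsion_free R.
Proof.
suff tf n (x : R) : (0 < n)%N -> x *+ n = 0 -> x = 0.
  move=> [] n x n0; first by rewrite -pmulrn; apply: tf; rewrite lt0n.
  by rewrite NegzE mulrNz -pmulrn => /eqP; rewrite oppr_eq0 => /eqP /tf->.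
elim/ltn_ind: n x => n IHn x n0 xn0.
case: (ltngtP n 1) => [||n1]; [by lia| |by move: xn0; rewrite n1].
(* With [n = q * p] and [p] prime, [p] kills [x *+ q], so [x *+ q = 0] and induction applies to
   [q < n]. *)
move=> n1; have p_pr := pdiv_prime n1; have /dvdnP[q Eq] := pdiv_dvd n.
have q0 : (0 < q)%N by move: n0; rewrite Eq muln_gt0 => /andP[].
apply: (IHn q) => //.
  by rewrite Eq ltn_Pmulr // prime_gt1.
by apply: (prime_torsion p_pr); rewrite mulr_natl -mulrnA -Eq.
Qed.

End Operations.

Theorem theorem2 (R : comPzRingType) :
  binomial_ring R <->
  exists bin : R -> nat -> R, binomial_operations bin.
Proof.
split=> [[tfR hbin]|[bin binP]].
  have [bin binE] := choice (fun x : R * nat => hbin x.2 x.1).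
  exists (fun r n => bin (r, n)).
  apply: binomial_operations_of_factorial => // r n.
  by apply: rtens_in_binom => //; exact: (binE (r, n)).
split=> [|n r]; first exact: binomial_operations_torsion_free binP.
exists (bin r n); rewrite rtens_binomE -(binop_factorial binP).
rewrite rmorphM rmorph_nat mulr_natl -scaler_nat scalerA.
by rewrite mulVf ?scale1r // fact_ratr_neq0.
Qed.
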